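(* Let $\gamma\in(0,\tfrac12)$ and $\tau\geq 1$. Define the map $$\Phi_{\gamma,\tau}(z):=\frac{\eta z+1}{(2\eta+1)z+2},\qquad \text{with}\quad \eta:=\Big[\frac{2^{\tau}\,3}{\gamma}\Big].$$ Then $\Phi_{\gamma,\tau}(D_{\gamma,\tau})\subseteq D_{\tau}$. Moreover, for every $\alpha\in\Phi_{\gamma,\tau}(D_{\gamma,\tau})$ there exist $\tau_\alpha>\tau$ and $\gamma_\alpha>0$ such that $\alpha$ is an isolated point of $D_{\gamma_\alpha,\tau_\alpha}$.
   Context: $\mathbb{N}=\{1,2,3,\dots\}$. For $x\in\mathbb{R}$, $[x]$ denotes the integral part of $x$ and $\|x\|:=\min_{p\in\mathbb{Z}}|x-p|$. For $\gamma>0$ and $\tau\geq 1$, $$D_{\gamma,\tau}:=\{\alpha\in(0,1): \|q\alpha\|\geq \gamma/q^{\tau}\ \text{ for all } q\in\mathbb{N}\},\qquad D_\tau:=\bigcup_{\gamma>0}D_{\gamma,\tau}.$$ Isolated points are taken with respect to the topology induced from $\mathbb{R}$. *)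

(* Defs.v *)
From mathcomp Require Import all_boot all_order all_algebra.
From mathcomp Require Import all_classical all_reals all_analysis.
Import Order.TTheory GRing.Theory Num.Theory.
Import numFieldNormedType.Exports.

Set Implicit Arguments.
Unset Strict Implicit.
Unset Printing Implicit Defensive.

Local Open Scope classical_set_scope.
Local Open Scope ring_scope.

(* The infimum is attained: see [dist_intP] and [dist_int_le]. *)
Definition dist_int (R : realType) (x : R) : R :=
  inf [set `|x - p%:~R| | p in [set: int]].

Lemma dist_int_le (R : realType) (x : R) (p : int) :
  dist_int x <= `|x - p%:~R|.
Proof.
apply: ge_inf; last by exists p.
by exists 0 => _ [q _ <-]; exact: normr_ge0.
Qed.

Lemma dist_intP (R : realType) (x : R) :
  exists p : int, dist_int x = `|x - p%:~R|.
Proof.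
have /andP[h1 h2] := floor_itv x.
set n := Num.floor x in h1 h2.
have [p hp] : exists p : int, forall q : int, `|x - p%:~R| <= `|x - q%:~R|.
  have key (q : int) : `|x - n%:~R| <= `|x - q%:~R| \/
                       `|x - (n + 1)%:~R| <= `|x - q%:~R|.
    have [qn|nq] := leP q n.
      left; have q_le : (q%:~R : R) <= n%:~R by rewrite ler_int.
      rewrite !ger0_norm ?subr_ge0 //; last exact: le_trans h1.
      by rewrite lerD2l lerN2.
    right; have le_q : ((n + 1)%:~R : R) <= q%:~R by rewrite ler_int lezD1.
    rewrite !ler0_norm ?subr_le0; [|exact: le_trans (ltW h2) _|exact: ltW].
    by rewrite !opprB lerD2r.
  have [le01|/ltW le10] := leP `|x - n%:~R| `|x - (n + 1)%:~R|.
    by exists n => q; case: (key q) => // /(le_trans le01).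
  by exists (n + 1) => q; case: (key q) => // /(le_trans le10).
exists p; apply/le_anti; rewrite dist_int_le /=.
apply: lb_le_inf; first by exists `|x - p%:~R|, p.
by move=> _ [q _ <-].
Qed.

Definition Dset (R : realType) (gamma tau : R) : set R :=
  [set alpha : R | 0 < alpha < 1 /\
     forall q : nat, (0 < q)%N ->
       gamma / (q%:R `^ tau) <= dist_int (q%:R * alpha)].

Definition Dtau (R : realType) (tau : R) : set R :=
  \bigcup_(gamma in [set g : R | 0 < g]) Dset gamma tau.

Definition eta (R : realType) (gamma tau : R) : int :=
  Num.floor (2 `^ tau * 3 / gamma).

Definition Phi (R : realType) (gamma tau z : R) : R :=
  ((eta gamma tau)%:~R * z + 1) / ((2 * (eta gamma tau)%:~R + 1) * z + 2).

(* Main.v *)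
Require Import Defs.
From mathcomp Require Import all_boot all_order all_algebra.
From mathcomp Require Import all_classical all_reals all_analysis.
From mathcomp Require Import ring lra zify.
Import Order.TTheory GRing.Theory Num.Theory.
Import numFieldNormedType.Exports.

(** Write [alpha = (e z + 1) / D] with [D = (2 e + 1) z + 2], for an integer
    [e]; this is the continued fraction [alpha = 1 / (2 + 1 / (e + 1 / z))].
    So [alpha] lies just below [1/2], and with [X = e + 1 / z] one has
    [alpha = X / (2 X + 1)] and [1 - 2 alpha = 1 / (2 X + 1)], that is,
    [alpha = X (1 - 2 alpha)].

    The isolating exponent [t] is the solution of [2 ^ t = X], and the isolating
    constant is [alpha] itself.  With this choice the inequality
    [alpha / q ^ t <= || q alpha ||] is an equality both for [q = 1], where
    [|| alpha || = alpha], and for [q = 2], where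
    [2 ^ t * || 2 alpha || = X (1 - 2 alpha)].  Moving [alpha] to the left
    violates the condition at [q = 1], and moving it to the right, up to [1/2],
    violates the condition at [q = 2]; so [alpha] is isolated
    ([isolated_extremal]) as soon as it satisfies the condition for the
    remaining [q] ([mobius_extremal_Dset]).

    For the latter, pull the approximation [q alpha - p] back to [z]:
    [D (q alpha - p) = m z + n] with [n = q - 2 p] and [m = e n - p]
    ([mobius_error]), while [m = (2 e + 1) (q alpha - p) - q / D].  A good
    approximation therefore has [|m| <= q / D + 1] ([pull_coef_le]), and the
    Diophantine property of [z] applied to [|m|] bounds the error from below
    ([mobius_error_ge]).  With the crude bound [|m| <= 2 q] this already shows
    that [alpha] is Diophantine with the same exponent ([mobius_Dtau]).

    For [2 <= q], if [n = 0] then [p / q = 1 / 2], and the condition follows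
    from the equality at [2].  If [n <> 0] then [|m|] is at least [e - |p|], so
    a good approximation has a large [q] ([denominator_ge4]); then
    [|m| <= q / 2], and
    [q ^ (t - tau) >= (2 ^ (t - tau)) ^ 2 = (X / 2 ^ tau) ^ 2].  One factor
    [X / 2 ^ tau] is at least [3 / gamma] by the choice of [e] as the integral
    part of [2 ^ tau * 3 / gamma] and absorbs the constant [gamma]; the bound
    [q / 2] on [|m|] gains the factor [2 ^ tau] that remains. *)

Local Open Scope classical_set_scope.
Local Open Scope ring_scope.

Definition mobius_den {R : realType} (e : int) (z : R) : R :=
  (2 * e%:~R + 1) * z + 2.

Definition mobius {R : realType} (e : int) (z : R) : R :=
  (e%:~R * z + 1) / mobius_den e z.

Lemma mobius_den_gt2 (R : realType) (e : int) (z : R) :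
  0 <= e -> 0 < z -> 2 < mobius_den e z.
Proof.
move=> e_ge0 z_gt0; have e0 : 0 <= e%:~R :> R by rewrite ler0z.
by rewrite /mobius_den; nra.
Qed.

(** The distance from [2 alpha] to the nearest integer, [alpha] being the image
    of [z]: the image lies below [1/2], and approaches it as [e] grows. *)
Lemma one_sub_double_mobius (R : realType) (e : int) (z : R) :
  0 <= e -> 0 < z -> 1 - 2 * mobius e z = z / mobius_den e z.
Proof.
move=> e_ge0 z_gt0; have := mobius_den_gt2 R e z e_ge0 z_gt0.
by rewrite /mobius /mobius_den => D_gt2; field; rewrite gt_eqF //; lra.
Qed.

Lemma mobius_itv (R : realType) (e : int) (z : R) :
  0 <= e -> 0 < z -> 0 < mobius e z < 1 / 2.
Proof.
move=> e_ge0 z_gt0; have D_gt2 := mobius_den_gt2 R e z e_ge0 z_gt0.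
have e0 : 0 <= e%:~R :> R by rewrite ler0z.
apply/andP; split; first by rewrite divr_gt0 //; nra.
suff : 0 < 1 - 2 * mobius e z by lra.
by rewrite one_sub_double_mobius // divr_gt0 //; lra.
Qed.

(** The coefficient of [z] when [q alpha - p] is pulled back to a linear form
    in [z]; the constant term of that form is [q - 2 p]. *)
Definition pull_coef (e : int) (q : nat) (p : int) : int :=
  e * (q%:Z - 2 * p) - p.

Lemma mobius_error (R : realType) (e : int) (z : R) (q : nat) (p : int) :
  0 <= e -> 0 < z ->
  q%:R * mobius e z - p%:~R =
  ((pull_coef e q p)%:~R * z + (q%:Z - 2 * p)%:~R) / mobius_den e z.
Proof.
move=> e_ge0 z_gt0; have := mobius_den_gt2 R e z e_ge0 z_gt0.
rewrite /mobius /mobius_den /pull_coef !rmorphB !rmorphM /= rmorphB rmorphM /=.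
by move=> D_gt2; rewrite -!pmulrn; field; rewrite gt_eqF //; lra.
Qed.

(** The matrix of the map has determinant [-1], hence
    [e - (2 e + 1) alpha = - 1 / D], where [D] is the denominator of [alpha]; so
    the coefficient equals [(2 e + 1) (q alpha - p) - q / D]. *)
Lemma pull_coef_le (R : realType) (e : int) (z : R) (q : nat) (p : int) :
  0 <= e -> 0 < z ->
  (2 * e%:~R + 1) * `|q%:R * mobius e z - p%:~R| <= 1 ->
  `|(pull_coef e q p)%:~R| <= q%:R / mobius_den e z + 1.
Proof.
move=> e_ge0 z_gt0; have D_gt2 := mobius_den_gt2 R e z e_ge0 z_gt0.
have e0 : 0 <= e%:~R :> R by rewrite ler0z.
have -> : (pull_coef e q p)%:~R =
    (2 * e%:~R + 1) * (q%:R * mobius e z - p%:~R)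
      - q%:R / mobius_den e z :> R.
  move: D_gt2; rewrite /mobius /mobius_den /pull_coef.
  rewrite !rmorphB !rmorphM /= rmorphB rmorphM /= -!pmulrn => D_gt2.
  by field; rewrite gt_eqF //; lra.
move=> small; apply: le_trans (ler_normB _ _) _.
rewrite normrM (ger0_norm (_ : 0 <= 2 * e%:~R + 1 :> R)); last by lra.
rewrite [X in _ + X]ger0_norm; last by rewrite divr_ge0 //; lra.
by rewrite addrC lerD2l.
Qed.

(** If [m] is nonzero this is the Diophantine condition for the denominator
    [|m|].  If [m = 0] the form is a nonzero integer, and
    [gamma <= B ^ tau] makes the claimed lower bound at most [1]. *)
Lemma Dset_linear_form_ge (R : realType) (gamma tau z B : R) (m n : int) :
  0 <= gamma -> 0 <= tau -> Dset gamma tau z ->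
  (m != 0) || (n != 0) -> `|m%:~R| <= B -> gamma <= B `^ tau ->
  gamma / B `^ tau <= `|m%:~R * z + n%:~R|.
Proof.
move=> gamma_ge0 tau_ge0 [_ dioph] mn_neq0 m_le gamma_le.
have B_ge0 : 0 <= B := le_trans (normr_ge0 _) m_le.
have [m0|m_neq0] := eqVneq m 0.
  move: mn_neq0; rewrite m0 eqxx /= => n_neq0.
  rewrite mul0r add0r.
  apply: (@le_trans _ _ 1).
    have [->|Bt] := eqVneq (B `^ tau) 0; first by rewrite invr0 mulr0.
    by rewrite ler_pdivrMr ?mul1r // lt0r Bt powR_ge0.
  by rewrite -intr_norm (ler_int _ 1) -gtz0_ge1 normr_gt0.
have m_gt0 : (0 < `|m|)%N by rewrite absz_gt0.
have absE : (`|m|%N)%:R = `|m%:~R| :> R by rewrite pmulrn abszE intr_norm.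
have := dioph _ m_gt0; rewrite absE => dm.
apply: (@le_trans _ _ (gamma / `|m%:~R| `^ tau)).
  rewrite ler_wpM2l // lef_pV2 ?posrE ?powR_gt0 ?normr_gt0 ?intr_eq0 //.
    by apply: ge0_ler_powR; rewrite ?nnegrE.
  by apply: lt_le_trans m_le; rewrite normr_gt0 intr_eq0.
apply: le_trans dm _.
have [m_ge0|m_lt0] := leP 0 m.
  apply: le_trans (dist_int_le _ (- n)) _.
  by rewrite (ger0_norm (_ : 0 <= m%:~R)) ?ler0z // mulrNz opprK.
apply: le_trans (dist_int_le _ n) _.
rewrite (ltr0_norm (_ : m%:~R < 0)) ?ltrz0 // -normrN.
by rewrite (_ : - (_ - _) = m%:~R * z + n%:~R) //; ring.
Qed.

(** The pulled back form is not identically zero: [q - 2 p = 0] turns its first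
    coefficient into [- p], and [p = 0] would give [q = 0]. *)
Lemma mobius_error_ge (R : realType) (e : int) (gamma tau z B : R)
    (q : nat) (p : int) :
  0 <= e -> 0 <= gamma -> 0 <= tau -> Dset gamma tau z -> (0 < q)%N ->
  `|(pull_coef e q p)%:~R| <= B -> gamma <= B `^ tau ->
  gamma / B `^ tau / mobius_den e z <= `|q%:R * mobius e z - p%:~R|.
Proof.
move=> e_ge0 gamma_ge0 tau_ge0 zD q_gt0 m_le gamma_le.
have [/andP[z_gt0 _] _] := zD.
have D_gt2 := mobius_den_gt2 R e z e_ge0 z_gt0.
have D_gt0 : 0 < mobius_den e z by lra.
rewrite mobius_error // normrM normfV (gtr0_norm D_gt0) ler_pM2r ?invr_gt0 //.
apply: Dset_linear_form_ge => //.
apply/orP; have [n0|] := eqVneq (q%:Z - 2 * p) 0; [left | by right].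
by rewrite /pull_coef n0 mulr0 sub0r oppr_eq0; lia.
Qed.

(** Either [|q alpha - p|] exceeds the fixed constant [1 / (2 e + 1)], or the
    form pulled back to [z] has a coefficient of size at most [2 q], which
    costs only a constant factor. *)
Lemma mobius_Dtau (R : realType) (e : int) (gamma tau z : R) :
  0 <= e -> 0 < gamma <= 1 -> 0 <= tau ->
  Dset gamma tau z -> Dtau tau (mobius e z).
Proof.
move=> e_ge0 /andP[gamma_gt0 gamma_le1] tau_ge0 zD.
have [/andP[z_gt0 _] _] := zD.
have D_gt2 := mobius_den_gt2 R e z e_ge0 z_gt0.
have /andP[al_gt0 al_lt] := mobius_itv R e z e_ge0 z_gt0.
have e0 : 0 <= e%:~R :> R by rewrite ler0z.
have E_gt0 : 0 < 2 * e%:~R + 1 :> R by lra.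
have D_gt0 : 0 < mobius_den e z by lra.
(* [c1] handles the poor approximations, [c2] the good ones. *)
set c1 := (2 * e%:~R + 1)^-1 : R.
set c2 := gamma / 2 `^ tau / mobius_den e z.
exists (Num.min c1 c2).
  by rewrite /= lt_min invr_gt0 E_gt0 !divr_gt0 ?powR_gt0.
split=> [|q q_gt0]; first by rewrite al_gt0; lra.
have [p ->] := dist_intP (q%:R * mobius e z).
have q1 : 1 <= q%:R :> R by rewrite ler1n.
have qt1 : 1 <= q%:R `^ tau by rewrite -[leLHS](powRr0 q%:R) ler_powR.
have qt0 : 0 < q%:R `^ tau by lra.
have [small|large] :=
    leP ((2 * e%:~R + 1) * `|q%:R * mobius e z - p%:~R|) 1; last first.
  apply: (@le_trans _ _ c1); last first.
    by rewrite -[c1]mul1r ler_pdivrMr // mulrC ltW.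
  rewrite ler_pdivrMr //; apply: (@le_trans _ _ c1).
    by rewrite ge_min lexx.
  by rewrite ler_peMr // invr_ge0 ltW.
have m_le := pull_coef_le R e z q p e_ge0 z_gt0 small.
have m_le2 : `|(pull_coef e q p)%:~R| <= 2 * q%:R :> R.
  apply: le_trans m_le _.
  suff : q%:R / mobius_den e z <= q%:R by lra.
  by rewrite ler_piMr // invf_le1 //; lra.
have := mobius_error_ge R e gamma tau z _ q p e_ge0 (ltW gamma_gt0) tau_ge0 zD
  q_gt0 m_le2.
have B1 : 1 <= (2 * q%:R) `^ tau :> R.
  by rewrite -[leLHS](powRr0 (2 * q%:R)) ler_powR //; lra.
move=> /(_ (le_trans gamma_le1 B1)); apply: le_trans.
apply: (@le_trans _ _ (c2 / q%:R `^ tau)).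
  by rewrite ler_pM2r ?invr_gt0 // ge_min lexx orbT.
rewrite powRM // /c2.
have t0 : 0 < 2 `^ tau :> R by rewrite powR_gt0.
rewrite le_eqVlt; apply/orP; left; apply/eqP.
by field; rewrite !gt_eqF.
Qed.

(** The hypothesis says that the defining inequality of the set is an equality
    at [q = 2]; with the constant equal to [a] it is one at [q = 1] too.  These
    two constraints pin [a] from the right and from the left respectively. *)
Lemma isolated_extremal (R : realType) (a t : R) :
  a < 1 / 2 -> 2 `^ t * (1 - 2 * a) = a -> Dset a t a ->
  isolated (Dset a t) a.
Proof.
move=> a_lt ext aD; split; first exact: mem_set.
have two_gt0 : 0 < 2 `^ t :> R by rewrite powR_gt0.
exists `]-oo, (1 / 2)[%classic.
  by apply: open_nbhs_nbhs; split; [exact: interval_open | rewrite /= in_itv].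
apply/seteqP; split=> [b|_ ->]; last by split=> //=; rewrite in_itv.
rewrite /= in_itv /= => -[b_lt [/andP[b_gt0 _] bD]].
apply/le_anti/andP; split.
  have := le_trans (bD 2 isT) (dist_int_le _ 1).
  rewrite ltr0_norm ?opprB; last by lra.
  by rewrite ler_pdivrMr // -{1}ext [leRHS]mulrC ler_pM2l //; lra.
have := le_trans (bD 1%N isT) (dist_int_le _ 0).
by rewrite powR1 divr1 mul1r subr0 gtr0_norm.
Qed.

(** Applied with [n = q - 2 p]: as [|e n|] is at least [e], the difference
    [e n - p] can only be small if [p] is comparable to [e], and then so is [q].
    Already [4] is enough to gain a square in the exponent. *)
Lemma denominator_ge4 (R : realFieldType) (e n p q : R) :
  12 <= e -> 1 <= `|n| -> - 1 <= p <= q / 2 + 1 ->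
  `|e * n - p| <= q / 4 + 1 -> 4 <= q.
Proof.
move=> e12 n1 /andP[p_lb p_ub]; rewrite ler_norml => /andP[m_lb m_ub].
have en : e <= `|e * n| by rewrite normrM ger0_norm ?ler_peMr //; lra.
by move: en; case: ger0P => _ en; lra.
Qed.

(** The hypothesis on [2 ^ t] makes the condition an equality for [q = 1] and
    [q = 2]; the lower bound on [e] makes every other denominator harmless. *)
Lemma mobius_extremal_Dset (R : realType) (e : int) (gamma tau t z : R) :
  12 <= e -> 0 < gamma <= 1 -> 1 <= tau ->
  2 `^ tau * 3 / gamma < (e + 1)%:~R ->
  Dset gamma tau z -> 2 `^ t = e%:~R + z^-1 ->
  Dset (mobius e z) t (mobius e z).
Proof.
move=> e12 /andP[gamma_gt0 gamma_le1] tau_ge1 e_large zD XE.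
have [/andP[z_gt0 z_lt1] zdioph] := zD.
have e_ge0 : 0 <= e by lia.
have D_gt2 := mobius_den_gt2 R e z e_ge0 z_gt0.
have /andP[al_gt0 al_lt] := mobius_itv R e z e_ge0 z_gt0.
have eR12 : 12 <= e%:~R :> R by rewrite (ler_int _ 12).
have twot : 2 <= 2 `^ tau :> R by rewrite -{1}[2]powRr1 // ler_powR //; lra.
move: e_large; rewrite ltr_pdivrMr // rmorphD /= => e_large.
(* The case [q = 1] of the Diophantine condition on [z]. *)
have z_ge : gamma <= z.
  have := le_trans (zdioph 1%N isT) (dist_int_le _ 0).
  by rewrite powR1 divr1 mul1r subr0 gtr0_norm.
have D_ge4 : 4 <= mobius_den e z by rewrite /mobius_den; nra.
have D_gt0 : 0 < mobius_den e z by lra.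
set X := 2 `^ t in XE.
have zV : 1 < z^-1 by rewrite invf_gt1.
have X_gt : e%:~R + 1 < X by rewrite XE ltrD2l.
have alE : mobius e z = X * (z / mobius_den e z).
  by rewrite XE /mobius; field; rewrite !gt_eqF.
have XgT : 2 `^ tau * 3 <= gamma * X by nra.
have tau_le_t : tau <= t.
  rewrite leNgt; apply/negP => /ltW t_lt.
  have : X <= 2 `^ tau by rewrite ler_powR //; lra.
  by nra.
split=> [|q q_gt0]; first by rewrite al_gt0; lra.
have [p ->] := dist_intP (q%:R * mobius e z).
rewrite ler_pdivrMr ?powR_gt0 ?ltr0n //.
have [q1|q_neq1] := eqVneq q 1%N.
  rewrite q1 powR1 mulr1 mul1r.
  have [p_le0|p_gt0] := leP p 0.
    have pR : p%:~R <= 0 :> R by rewrite lerz0.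
    by apply: le_trans (ler_norm _); lra.
  have pR : 1 <= p%:~R :> R by rewrite (ler_int _ 1).
  by rewrite -normrN; apply: le_trans (ler_norm _); lra.
have q2 : (2 <= q)%N by rewrite ltn_neqAle eq_sym q_neq1.
have qR2 : 2 <= q%:R :> R by rewrite (ler_nat _ 2).
have qR_gt0 : 0 < q%:R :> R by rewrite ltr0n.
have t_ge0 : 0 <= t by lra.
have X_le : X <= q%:R `^ t by rewrite ge0_ler_powR ?nnegrE //; lra.
have zD_gt0 : 0 < z / mobius_den e z by rewrite divr_gt0.
have [n0|n_neq0] := eqVneq (q%:Z - 2 * p) 0.
  rewrite {1}alE mulrC ler_pM //; [exact: ltW|by lra|].
  have qE : q%:R = 2 * p%:~R :> R.
    have -> : q%:R = q%:Z%:~R :> R by rewrite -pmulrn.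
    by rewrite (_ : q%:Z = 2 * p) ?rmorphM //; apply/eqP; rewrite -subr_eq0 n0.
  have pR : 1 <= p%:~R :> R by rewrite (ler_int _ 1); clear - n0 q2; lia.
  rewrite -one_sub_double_mobius // -normrN.
  by apply: le_trans (ler_norm _); rewrite qE; nra.
(* Now [p / q] differs from [1/2]; suppose that it violates the condition. *)
rewrite leNgt; apply/negP => del_lt.
set del := `|q%:R * mobius e z - p%:~R| in del_lt.
have del_ge0 : 0 <= del by exact: normr_ge0.
(* Since [X <= q ^ t], the error at [q] would be below that at [2]. *)
have del_lt2 : del < z / mobius_den e z.
  rewrite -(ltr_pM2l (_ : 0 < X)); last by lra.
  by rewrite -alE; apply: le_lt_trans del_lt; rewrite mulrC ler_wpM2l.
have Edel : (2 * e%:~R + 1) * del <= 1.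
  move: del_lt2; rewrite ltr_pdivlMr // /mobius_den => del_lt2; nra.
have m_le := pull_coef_le R e z q p e_ge0 z_gt0 Edel.
have qD : q%:R / mobius_den e z <= q%:R / 4.
  by rewrite ler_wpM2l // lef_pV2 ?posrE.
have q_ge4 : 4 <= q%:R :> R.
  have : `|q%:R * mobius e z - p%:~R| <= 1 by rewrite -/del; nra.
  rewrite ler_norml => /andP[err_lb err_ub].
  have p_ub : p%:~R <= q%:R / 2 + 1 :> R by nra.
  have p_lb : - 1 <= p%:~R :> R by nra.
  have mE : (pull_coef e q p)%:~R = e%:~R * (q%:Z - 2 * p)%:~R - p%:~R :> R.
    by rewrite /pull_coef rmorphB rmorphM.
  apply: (@denominator_ge4 R e%:~R (q%:Z - 2 * p)%:~R p%:~R) => //.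
  - by rewrite -intr_norm (ler_int _ 1) -gtz0_ge1 normr_gt0.
  - by rewrite p_lb.
  - by rewrite -mE; apply: le_trans m_le _; rewrite lerD2r.
(* As [q / 4 + 1 <= q / 2] exactly when [4 <= q]. *)
have m_le2 : `|(pull_coef e q p)%:~R| <= q%:R / 2 :> R by lra.
have tau_ge0 : 0 <= tau by lra.
have := mobius_error_ge R e gamma tau z _ q p e_ge0 (ltW gamma_gt0) tau_ge0 zD
  q_gt0 m_le2.
have B1 : 1 <= (q%:R / 2) `^ tau :> R.
  by rewrite -[leLHS](powRr0 (q%:R / 2)) ler_powR //; lra.
move=> /(_ (le_trans gamma_le1 B1)); rewrite -/del => del_ge.
have qt_gt0 : 0 < q%:R `^ tau :> R by rewrite powR_gt0.
have BE : (q%:R / 2) `^ tau = q%:R `^ tau / 2 `^ tau :> R.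
  by rewrite powRM // -powR_inv1 // powRAC powR_inv1 ?powR_ge0.
(* [4 <= q] and [4 ^ (t - tau) = (2 ^ (t - tau)) ^ 2]. *)
have q4 : (X / 2 `^ tau) ^+ 2 <= q%:R `^ t / q%:R `^ tau :> R.
  have powB (x : R) : 0 < x -> x `^ t / x `^ tau = x `^ (t - tau).
    by move=> x_gt0; rewrite powRB //; apply/implyP => _; rewrite gt_eqF.
  rewrite /X !powB //.
  rewrite -powR_mulrn ?powR_ge0 // powRAC powR_mulrn //.
  by rewrite ge0_ler_powR ?nnegrE ?subr_ge0 //; lra.
(* The assumed upper bound on the error meets the Diophantine lower bound. *)
have : del * q%:R `^ t < del * q%:R `^ t; last by rewrite ltxx.
apply: lt_le_trans del_lt _.
apply: (@le_trans _ _ (gamma * 2 `^ tau * (q%:R `^ t / q%:R `^ tau)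
                         / mobius_den e z)); last first.
  have -> : gamma * 2 `^ tau * (q%:R `^ t / q%:R `^ tau) / mobius_den e z =
      gamma / (q%:R / 2) `^ tau / mobius_den e z * q%:R `^ t.
    by rewrite BE; field; rewrite !gt_eqF // powR_gt0.
  by rewrite ler_wpM2r ?powR_ge0.
rewrite alE mulrA ler_pM2r ?invr_gt0 //.
apply: (@le_trans _ _ (gamma * 2 `^ tau * (X / 2 `^ tau) ^+ 2)); last first.
  by rewrite ler_wpM2l // mulr_ge0 ?powR_ge0 // ltW.
have -> : gamma * 2 `^ tau * (X / 2 `^ tau) ^+ 2 = gamma * X / 2 `^ tau * X.
  by field; rewrite gt_eqF //; lra.
rewrite mulrC ler_wpM2r //; first by lra.
by rewrite ler_pdivlMr; [nra | lra].
Qed.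

Theorem theoremA (R : realType) (gamma tau : R)
    (gamma_gt0 : 0 < gamma) (gamma_lt_half : gamma < 1 / 2)
    (tau_ge1 : 1 <= tau) :
  Phi gamma tau @` Dset gamma tau `<=` Dtau tau /\
  (forall alpha : R, (Phi gamma tau @` Dset gamma tau) alpha ->
     exists tau_alpha gamma_alpha : R,
       tau < tau_alpha /\ 0 < gamma_alpha /\
       isolated (Dset gamma_alpha tau_alpha) alpha).
Proof.
have gamma01 : 0 < gamma <= 1 by rewrite gamma_gt0; lra.
have twot : 2 <= 2 `^ tau :> R by rewrite -{1}[2]powRr1 // ler_powR //; lra.
have e12 : 12 <= eta gamma tau.
  by rewrite /eta floor_ge_int; rewrite ler_pdivlMr //; nra.
have e_ge0 : 0 <= eta gamma tau by lia.
have e_large : 2 `^ tau * 3 / gamma < (eta gamma tau + 1)%:~R.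
  exact: floorD1_gt.
have PhiE z : Phi gamma tau z = mobius (eta gamma tau) z by [].
split=> [_ [z zD <-]|_ [z zD <-]]; rewrite PhiE.
  apply: (@mobius_Dtau R _ gamma) => //; exact: le_trans ler01 tau_ge1.
move: (eta gamma tau) e12 e_ge0 e_large {PhiE} => e e12 e_ge0 e_large.
have [/andP[z_gt0 z_lt1] _] := zD.
have /andP[al_gt0 al_lt] := mobius_itv R e z e_ge0 z_gt0.
have D_gt2 := mobius_den_gt2 R e z e_ge0 z_gt0.
have eR12 : 12 <= e%:~R :> R by rewrite (ler_int _ 12).
have zV : 1 < z^-1 by rewrite invf_gt1.
have ln2 : 0 < ln 2 :> R by rewrite ln_gt0 //; lra.
have XE : 2 `^ (ln (e%:~R + z^-1) / ln 2) = e%:~R + z^-1.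
  rewrite /powR pnatr_eq0 /= divfK ?gt_eqF // lnK // posrE; lra.
exists (ln (e%:~R + z^-1) / ln 2), (mobius e z); split; last split => //.
  rewrite ltNge; apply/negP => t_le.
  have := ler_powR (_ : 1 <= 2) t_le; rewrite XE => /(_ (ler1n _ 2)).
  move: e_large; rewrite ltr_pdivrMr // rmorphD /=; nra.
apply: isolated_extremal => //.
  rewrite XE one_sub_double_mobius // /mobius; field; rewrite !gt_eqF //; lra.
exact: (@mobius_extremal_Dset R e gamma tau).
Qed.
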